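(* Let $d\in\{4,6,8\}$, $\lambda=(d-2)/2$ and $n\in\mathbb{N}_0$. Then $$F_n^{\lambda}(t)=\int_0^t (t-\theta)^{\lambda+1}\,C_n^{\lambda}(\cos\theta)\,(\sin\theta)^{2\lambda}\,d\theta>0$$ for all $0<t\le\pi$.
   Context: $\mathbb{N}_0=\{0,1,2,\ldots\}$. $C_n^{\lambda}$ denotes the Gegenbauer (ultraspherical) polynomial of degree $n$ with parameter $\lambda$ in the standard normalization, $\sum_{n\ge 0}C_n^{\lambda}(x)r^n=(1-2xr+r^2)^{-\lambda}$. *)

(* Defs.v *)
From Stdlib Require Import Reals Factorial.
From Coquelicot Require Import Coquelicot.
Open Scope R_scope.

Definition gegenbauer_gen (lam x r : R) : R :=
  Rpower (1 - 2 * x * r + r ^ 2) (- lam).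

(* C_n^lam(x) is the coefficient of r^n in the power series expansion at r = 0
   of the generating function, which is analytic there for every real x: the
   base of the power tends to 1, so [Rpower] is the true real power near 0. *)
Definition gegenbauer (lam : R) (n : nat) (x : R) : R :=
  Derive_n (gegenbauer_gen lam x) n 0 / INR (fact n).

(* The parameter is a natural number, so that the exponents lam + 1 and
   2 * lam are natural powers, with the right value also at base 0. *)
Definition F (lam n : nat) (t : R) : R :=
  RInt (fun theta : R =>
          (t - theta) ^ (lam + 1)
          * gegenbauer (INR lam) n (cos theta)
          * (sin theta) ^ (2 * lam)) 0 t.

(* Main.v *)
(** The cosine expansion of the integrand shows that the Laplace transform of
    [F lam n] is a positive multiple of the product of the factors
    [1 / (s (s^2 + k^2))] for [k = n, n + 2, ..., n + 2 lam].  Each factor is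
    the transform of [(1 - cos (k t)) / k^2 >= 0], so [F lam n] is an iterated
    convolution of nonnegative functions.  Convolving [f] with the factor of
    index [k] amounts to solving [y''' + k^2 y' = f] with zero initial data,
    and this is the form in which positivity is propagated here. *)
Require Import Defs.
From Stdlib Require Import Reals Lra Lia Factorial.
From Coquelicot Require Import Coquelicot.
Open Scope R_scope.

(** * Iterated integrals of the cosine *)

(** The transform of [icos k j] is s^(1-j) / (s^2 + k^2), so [icos k 2] is the kernel of the factor
    of index [k]. Defining it by integration covers [k = 0], where (1 - cos (k t)) / k^2 has no
    meaning. *)
Fixpoint icos (k : R) (j : nat) : R -> R :=
  match j with
  | O => fun t => cos (k * t)
  | S j => fun t => RInt (icos k j) 0 t
  end.

Lemma continuous_icos_0 (k t : R) : continuous (icos k 0) t.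
Proof.
  apply (ex_derive_continuous (V := R_NormedModule)). simpl. auto_derive. auto.
Qed.

Lemma is_derive_RInt_0 (f : R -> R) (t : R) :
  (forall x, continuous f x) -> is_derive (fun t => RInt f 0 t) t (f t).
Proof.
  intros Hf. apply (is_derive_RInt f (fun t => RInt f 0 t) 0 t); [|apply Hf].
  apply filter_forall. intros x. apply (RInt_correct (V := R_CompleteNormedModule)).
  apply (ex_RInt_continuous (V := R_CompleteNormedModule)). intros; apply Hf.
Qed.

Lemma continuous_icos (k : R) (j : nat) (t : R) : continuous (icos k j) t.
Proof.
  revert t. induction j as [|j IH]; intros t; [apply continuous_icos_0|].
  apply (ex_derive_continuous (V := R_NormedModule)). exists (icos k j t).
  apply (is_derive_RInt_0 (icos k j)), IH.
Qed.

Lemma is_derive_icos (k : R) (j : nat) (t : R) :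
  is_derive (icos k (S j)) t (icos k j t).
Proof. apply (is_derive_RInt_0 (icos k j)), continuous_icos. Qed.

Lemma icos_S_0 (k : R) (j : nat) : icos k (S j) 0 = 0.
Proof. exact (RInt_point 0 (icos k j)). Qed.

Lemma eq_of_derive (f g df : R -> R) (t : R) :
  (forall x, is_derive f x (df x)) -> (forall x, is_derive g x (df x)) ->
  f 0 = g 0 -> f t = g t.
Proof.
  intros Hf Hg H0.
  destruct (MVT_gen (fun x => f x - g x) 0 t (fun _ => 0)) as [c [_ Hc]].
  - intros x _. replace 0 with (df x - df x) by ring.
    apply (is_derive_minus (V := R_NormedModule)); auto.
  - intros x _. apply continuity_pt_filterlim.
    apply (continuous_minus (V := R_NormedModule));
      apply (ex_derive_continuous (V := R_NormedModule)); eexists; eauto.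
  - lra.
Qed.

Lemma is_derive_pow_fact (j : nat) (t : R) :
  is_derive (fun t => t ^ S j / INR (fact (S j))) t (t ^ j / INR (fact j)).
Proof.
  assert (Hc : INR (fact (S j)) = INR (S j) * INR (fact j))
    by (rewrite fact_simpl, mult_INR; reflexivity).
  rewrite Hc. pose proof (INR_fact_neq_0 j).
  assert (INR (S j) <> 0) by (apply not_0_INR; lia).
  set (c := INR (S j)) in *.
  evar_last.
  - apply (is_derive_ext (fun t => / (c * INR (fact j)) * t ^ S j));
      [intros; apply Rmult_comm|].
    apply is_derive_scal, is_derive_pow, is_derive_id.
  - fold c. unfold one, c; simpl. fold c. field. auto.
Qed.

Lemma icos_1 (k t : R) : k * icos k 1 t = sin (k * t).
Proof.
  apply (eq_of_derive (fun t => k * icos k 1 t) (fun t => sin (k * t))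
           (fun t => k * cos (k * t))).
  - intros x. apply (is_derive_scal (icos k 1)), (is_derive_icos k 0).
  - intros x. auto_derive; [auto|ring].
  - rewrite icos_S_0, !Rmult_0_r, sin_0. ring.
Qed.

(** Both sides have the same derivative, by [icos_1] for [j = 0] and by the preceding case
    afterwards, and they agree at 0. *)
Lemma icos_SS (k : R) (j : nat) (t : R) :
  k ^ 2 * icos k (S (S j)) t + icos k j t = t ^ j / INR (fact j).
Proof.
  revert t. induction j as [|j IH]; intros t.
  - apply (eq_of_derive (fun t => k ^ 2 * icos k 2 t + icos k 0 t)
             (fun t => t ^ 0 / INR (fact 0)) (fun _ => 0)).
    + intros x. replace 0 with (k ^ 2 * icos k 1 x + - (k * sin (k * x)))
        by (rewrite <- icos_1; ring).
      apply (is_derive_plus (V := R_NormedModule)).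
      * apply is_derive_scal, is_derive_icos.
      * simpl. auto_derive; [auto|ring].
    + intros x. simpl. auto_derive; auto.
    + rewrite icos_S_0. simpl. rewrite !Rmult_0_r, cos_0. field.
  - apply (eq_of_derive (fun t => k ^ 2 * icos k (S (S (S j))) t + icos k (S j) t)
             (fun t => t ^ S j / INR (fact (S j))) (fun t => t ^ j / INR (fact j))).
    + intros x. rewrite <- IH.
      apply (is_derive_plus (V := R_NormedModule)).
      * apply is_derive_scal, is_derive_icos.
      * apply is_derive_icos.
    + apply is_derive_pow_fact.
    + rewrite !icos_S_0. simpl. unfold Rdiv. ring.
Qed.

Lemma icos_2_mul (k t : R) : k ^ 2 * icos k 2 t = 1 - cos (k * t).
Proof. pose proof (icos_SS k 0 t) as H. simpl in *. lra. Qed.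

Lemma icos_0_2 (t : R) : icos 0 2 t = t ^ 2 / 2.
Proof. pose proof (icos_SS 0 2 t) as H. simpl in *. lra. Qed.

Lemma icos_2_ge0 (k t : R) : 0 <= icos k 2 t.
Proof.
  destruct (Req_dec k 0) as [->|Hk].
  - rewrite icos_0_2. nra.
  - pose proof (icos_2_mul k t) as H. pose proof (COS_bound (k * t)).
    apply Rmult_le_reg_l with (k ^ 2); [apply pow2_gt_0; auto|lra].
Qed.

Lemma cos_lt_1 (x : R) : 0 < x < 2 * PI -> cos x < 1.
Proof.
  intros Hx. pose proof (cos_2a_sin (x / 2)) as H.
  replace (2 * (x / 2)) with x in H by field.
  assert (0 < sin (x / 2)) by (apply sin_gt_0; lra). nra.
Qed.

Lemma icos_2_gt0 (k : R) :
  0 <= k -> exists d, 0 < d /\ forall t, 0 < t < d -> 0 < icos k 2 t.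
Proof.
  intros Hk. pose proof PI_RGT_0. destruct (Req_dec k 0) as [->|Hk0].
  - exists 1. split; [lra|]. intros t Ht. rewrite icos_0_2. nra.
  (* The first positive zero of 1 - cos (k t). *)
  - exists (2 * PI / k). assert (0 < k) by lra. split.
    + apply Rdiv_lt_0_compat; lra.
    + intros t [Ht Htd]. apply Rmult_lt_reg_l with (k ^ 2); [nra|].
      rewrite icos_2_mul, Rmult_0_r.
      assert (k * t < 2 * PI).
      { apply Rmult_lt_compat_l with (r := k) in Htd; [|lra].
        replace (k * (2 * PI / k)) with (2 * PI) in Htd by (field; lra). lra. }
      assert (0 < k * t) by nra.
      pose proof (cos_lt_1 (k * t)). lra.
Qed.

(** Two zeros of the kernel at distance [e] would force cos (k e) = 1 by the addition formula,
    against positivity close to 0. So one of two nearby points works. *)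
Lemma icos_2_dense (k a b : R) :
  0 <= k -> 0 < a -> a < b -> exists c, a < c < b /\ 0 < icos k 2 c.
Proof.
  intros Hk Ha Hab.
  destruct (icos_2_gt0 k Hk) as [d [Hd Hpos]].
  (* Small enough for [Hpos] to apply at [e] and for [a + e] and [a + e + e] to stay inside the
     interval. *)
  set (e := Rmin (d / 2) ((b - a) / 4)).
  assert (He : 0 < e < d /\ e < (b - a) / 3).
  { unfold e. pose proof (Rmin_l (d / 2) ((b - a) / 4)).
    pose proof (Rmin_r (d / 2) ((b - a) / 4)).
    assert (0 < Rmin (d / 2) ((b - a) / 4)) by (apply Rmin_glb_lt; lra). lra. }
  destruct (Rle_lt_or_eq_dec 0 _ (icos_2_ge0 k (a + e))) as [H1|H1].
  { exists (a + e). split; [lra|auto]. }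
  destruct (Rle_lt_or_eq_dec 0 _ (icos_2_ge0 k (a + e + e))) as [H2|H2].
  { exists (a + e + e). split; [lra|auto]. }
  exfalso. pose proof (Hpos e (proj1 He)) as H3.
  pose proof (icos_2_mul k (a + e)) as E1.
  pose proof (icos_2_mul k (a + e + e)) as E2.
  pose proof (icos_2_mul k e) as E3.
  assert (C1 : cos (k * (a + e)) = 1) by (rewrite <- H1 in E1; lra).
  replace (k * (a + e + e)) with (k * (a + e) + k * e) in E2 by ring.
  rewrite cos_plus, C1 in E2.
  assert (S1 : sin (k * (a + e)) = 0).
  { pose proof (sin2_cos2 (k * (a + e))) as H. rewrite C1 in H.
    unfold Rsqr in H. nra. }
  rewrite S1, <- H2 in E2.
  (* Now k^2 * icos k 2 e = 0 with a positive second factor. This leaves [k = 0], where the kernel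
     t^2 / 2 has no zero at [a + e]. *)
  assert (k = 0) by (destruct (Req_dec k 0); [auto|];
    assert (0 < k ^ 2) by (apply pow2_gt_0; auto); nra).
  subst k. rewrite icos_0_2 in H1. nra.
Qed.

(* Taylor's formula with integral remainder: the [Y j] are the successive
   antiderivatives of [Y 0] that vanish at [0]. *)
Lemma is_RInt_iterated (m : nat) (Y : nat -> R -> R) (t : R) :
  (forall j x, is_derive (Y (S j)) x (Y j x)) ->
  (forall x, continuous (Y 0%nat) x) ->
  (forall j, Y (S j) 0 = 0) ->
  is_RInt (fun x => (t - x) ^ m / INR (fact m) * Y 0%nat x) 0 t (Y (S m) t).
Proof.
  revert Y. induction m as [|m IH]; intros Y HY HC H0.
  - apply (is_RInt_ext (Y 0%nat)); [intros; simpl; field|].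
    replace (Y 1%nat t) with (minus (Y 1%nat t) (Y 1%nat 0))
      by (rewrite H0; unfold minus, plus, opp; simpl; ring).
    apply (is_RInt_derive (V := R_CompleteNormedModule)); auto.
  - assert (HC' : forall j x, continuous (Y j) x).
    { intros [|j] x; [apply HC|].
      apply (ex_derive_continuous (V := R_NormedModule)). eexists; apply HY. }
    assert (Hp : forall x, is_derive (fun x => (t - x) ^ S m / INR (fact (S m))) x
                   (- ((t - x) ^ m / INR (fact m)))).
    { intros x. evar_last.
      - apply (is_derive_comp (fun u => u ^ S m / INR (fact (S m))) (fun x => t - x)).
        + apply is_derive_pow_fact.
        + apply (is_derive_minus (V := R_NormedModule));
            [apply is_derive_const|apply is_derive_id].
      - unfold scal, minus, plus, opp, zero, one; simpl. unfold mult; simpl. ring. }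
    assert (Hq : forall n x, continuous (fun x => (t - x) ^ n / INR (fact n)) x).
    { intros n x. apply (ex_derive_continuous (V := R_NormedModule)).
      auto_derive. auto. }
    (* Integration by parts: the antiderivative [G] of [D] vanishes at [t] by the power and at 0 by
       [H0]. *)
    pose (D := fun x => - ((t - x) ^ m / INR (fact m)) * Y 1%nat x
                        + (t - x) ^ S m / INR (fact (S m)) * Y 0%nat x).
    assert (HD : is_RInt D 0 t 0).
    { pose (G := fun x => (t - x) ^ S m / INR (fact (S m)) * Y 1%nat x).
      replace 0 with (minus (G t) (G 0)) at 2.
      2:{ unfold G, minus, plus, opp; simpl. rewrite H0. unfold Rdiv. ring. }
      apply (is_RInt_derive (V := R_CompleteNormedModule)).
      - intros x _. apply (is_derive_mult (fun x => (t - x) ^ S m / INR (fact (S m)))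
          (Y 1%nat)); [apply Hp|apply HY|]. intros; apply Rmult_comm.
      - intros x _. unfold D.
        apply (continuous_plus (V := R_NormedModule)).
        + apply (continuous_mult (fun x => - ((t - x) ^ m / INR (fact m))));
            [apply (continuous_opp (V := R_NormedModule)), Hq|apply HC'].
        + apply (continuous_mult (fun x => (t - x) ^ S m / INR (fact (S m))));
            [apply Hq|apply HC']. }
    pose proof (IH (fun j => Y (S j)) (fun j => HY (S j)) (HC' 1%nat)
      (fun j => H0 (S j))) as HI.
    pose proof (is_RInt_plus _ _ _ _ _ _ HD HI) as HS.
    replace (Y (S (S m)) t) with (plus 0 (Y (S (S m)) t))
      by (unfold plus; simpl; ring).
    eapply is_RInt_ext; [|exact HS].
    intros x _.
    change (- ((t - x) ^ m / INR (fact m)) * Y 1%nat x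
            + (t - x) ^ S m / INR (fact (S m)) * Y 0%nat x
            + (t - x) ^ m / INR (fact m) * Y 1%nat x
            = (t - x) ^ S m / INR (fact (S m)) * Y 0%nat x).
    ring.
Qed.

(** * Propagation of positivity *)

Lemma nondecreasing_of_derive (f df : R -> R) (a b : R) :
  a <= b -> (forall x, is_derive f x (df x)) ->
  (forall x, a <= x <= b -> 0 <= df x) -> f a <= f b.
Proof.
  intros Hab Hf Hdf.
  destruct (MVT_gen f a b df) as [c [Hc E]].
  - intros; apply Hf.
  - intros x _. apply continuity_pt_filterlim.
    apply (ex_derive_continuous (V := R_NormedModule)). eexists; apply Hf.
  - rewrite Rmin_left, Rmax_right in Hc by lra.
    pose proof (Hdf c Hc). nra.
Qed.

(* With [g = icos k 2], the solution of the equation is the convolution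
   [y t = RInt (fun x => g (t - x) * f x) 0 t]; [Phi] below is an antiderivative
   of the integrand. *)
Lemma third_order_pos (k : R) (y y1 y2 f : R -> R) :
  0 <= k ->
  (forall x, is_derive y x (y1 x)) ->
  (forall x, is_derive y1 x (y2 x)) ->
  (forall x, is_derive y2 x (f x - k ^ 2 * y1 x)) ->
  y 0 = 0 -> y1 0 = 0 -> y2 0 = 0 ->
  (forall x, 0 <= x -> 0 <= f x) ->
  (forall a b, 0 < a -> a < b -> exists c, a < c < b /\ 0 < f c) ->
  forall t, 0 < t -> 0 < y t.
Proof.
  intros Hk D0 D1 D2 I0 I1 I2 Hf Hdense t Ht.
  pose (Phi := fun x => icos k 2 (t - x) * y2 x + icos k 1 (t - x) * y1 x + y x).
  assert (Hs : forall j x, is_derive (fun x => icos k (S j) (t - x)) x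
                             (- icos k j (t - x))).
  { intros j x. evar_last.
    - apply (is_derive_comp (icos k (S j)) (fun x => t - x)).
      + apply is_derive_icos.
      + apply (is_derive_minus (V := R_NormedModule));
          [apply is_derive_const|apply is_derive_id].
    - unfold scal, minus, plus, opp, zero, one; simpl. unfold mult; simpl. ring. }
  assert (HPhi : forall x, is_derive Phi x (icos k 2 (t - x) * f x)).
  { intros x. evar_last.
    - apply (is_derive_plus (V := R_NormedModule)); [|apply D0].
      apply (is_derive_plus (V := R_NormedModule)).
      + apply (is_derive_mult (fun x => icos k 2 (t - x)) y2);
          [apply (Hs 1%nat)|apply D2|intros; apply Rmult_comm].
      + apply (is_derive_mult (fun x => icos k 1 (t - x)) y1);
          [apply (Hs 0%nat)|apply D1|intros; apply Rmult_comm].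
    (* The [y2] terms cancel, and so do the [y1] terms, because 1 - cos (k u) = k^2 * icos k 2 u at
       u = t - x. *)
    - pose proof (icos_2_mul k (t - x)) as E.
      change (icos k 0 (t - x)) with (cos (k * (t - x))).
      replace (cos (k * (t - x))) with (1 - k ^ 2 * icos k 2 (t - x)) by lra.
      unfold plus, mult; simpl. ring. }
  assert (P0 : Phi 0 = 0) by (unfold Phi; rewrite I0, I1, I2; ring).
  assert (Pt : Phi t = y t).
  { unfold Phi. replace (t - t) with 0 by ring. rewrite !icos_S_0. ring. }
  assert (Hmono : forall a b, 0 <= a -> a <= b -> Phi a <= Phi b).
  { intros a b Ha Hab. apply (nondecreasing_of_derive Phi _ a b Hab HPhi).
    intros x Hx. apply Rmult_le_pos; [apply icos_2_ge0|apply Hf; lra]. }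
  rewrite <- Pt. destruct (Rle_lt_or_eq_dec 0 (Phi t)) as [H|H]; [|exact H|].
  { rewrite <- P0. apply Hmono; lra. }
  (* If [Phi t = 0], monotonicity makes [Phi] vanish on [0, t]. Its derivative is then 0 at some [c]
     so close to [t] that the kernel is positive there, with [f c] positive too. *)
  exfalso.
  destruct (icos_2_gt0 k Hk) as [d [Hd Hpos]].
  set (e := Rmin (d / 2) (t / 2)).
  assert (He : 0 < e < d /\ e < t).
  { unfold e. pose proof (Rmin_l (d / 2) (t / 2)).
    pose proof (Rmin_r (d / 2) (t / 2)).
    assert (0 < Rmin (d / 2) (t / 2)) by (apply Rmin_glb_lt; lra). lra. }
  destruct (Hdense (t - e) t) as [c [Hc Hfc]]; [lra|lra|].
  assert (Hz : is_derive Phi c 0).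
  { apply (is_derive_ext_loc (fun _ => 0)).
    - assert (Hr : 0 < Rmin c (t - c)) by (apply Rmin_glb_lt; lra).
      exists (mkposreal _ Hr). intros x Hx.
      change (Rabs (x - c) < Rmin c (t - c)) in Hx. apply Rabs_def2 in Hx.
      pose proof (Rmin_l c (t - c)). pose proof (Rmin_r c (t - c)).
      pose proof (Hmono 0 x). pose proof (Hmono x t). lra.
    - apply (is_derive_const (V := R_NormedModule) 0 c). }
  pose proof (is_derive_unique _ _ _ Hz) as E1.
  pose proof (is_derive_unique _ _ _ (HPhi c)) as E2.
  assert (0 < icos k 2 (t - c)) by (apply Hpos; lra). nra.
Qed.

(** * Gegenbauer polynomials *)

(** The rate 4 is preserved by the recurrence b_(n+2) = 2 x b_(n+1) - b_n + a_(n+2) for |x| <= 1,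
    and gives convergence for |r| < 1/4. *)
Definition geom_bounded (a : nat -> R) : Prop :=
  exists A, forall n, Rabs (a n) <= A * 4 ^ n.

Lemma geom_bounded_CV_radius (a : nat -> R) (r : R) :
  geom_bounded a -> Rabs r < / 4 -> Rbar_lt (Rabs r) (CV_radius a).
Proof.
  intros [A HA] Hr. apply Rbar_lt_le_trans with (/ 4); [exact Hr|].
  apply (proj1 (CV_radius_bounded a)). exists A. intros n.
  rewrite Rabs_mult, (Rabs_right ((/ 4) ^ n)) by (apply Rle_ge, pow_le; lra).
  rewrite pow_inv. pose proof (pow_lt 4 n).
  apply Rmult_le_reg_r with (4 ^ n); [lra|].
  rewrite Rmult_assoc, Rinv_l, Rmult_1_r by lra. apply HA.
Qed.

(** The generating function identity with the negative power cleared: free of [Rpower] and suited to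
    induction on [lam]. The bound makes the total function [PSeries] a genuine sum here. *)
Definition gegenbauer_coeffs (lam : nat) (x : R) (a : nat -> R) : Prop :=
  geom_bounded a /\
  forall r, Rabs r < / 4 -> PSeries a r * (1 - 2 * x * r + r ^ 2) ^ lam = 1.

Lemma gegenbauer_coeffs_0 (x : R) :
  gegenbauer_coeffs 0 x (fun n => match n with O => 1 | S _ => 0 end).
Proof.
  set (a := fun n => _).
  assert (Ha : geom_bounded a).
  { exists 1. intros [|n]; unfold a.
    - rewrite Rabs_R1. simpl. lra.
    - rewrite Rabs_R0. pose proof (pow_lt 4 (S n)). lra. }
  split; [exact Ha|]. intros r Hr.
  rewrite PSeries_decr_1 by (apply CV_radius_inside, geom_bounded_CV_radius; auto).
  rewrite (PSeries_ext _ (fun _ => 0)) by reflexivity.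
  rewrite PSeries_const_0. simpl. ring.
Qed.

Lemma geom_bounded_step (x : R) (a b : nat -> R) :
  Rabs x <= 1 -> geom_bounded a ->
  b 0%nat = a 0%nat -> b 1%nat = 2 * x * b 0%nat + a 1%nat ->
  (forall n, b (S (S n)) = 2 * x * b (S n) - b n + a (S (S n))) ->
  geom_bounded b.
Proof.
  (* The constant closes the induction: in units of A * 4^n, 2 * 12 + 3 + 16 <= 48. *)
  intros Hx [A HA] H0 H1 H2. exists (3 * A).
  assert (HA0 : 0 <= A).
  { pose proof (HA 0%nat) as H. pose proof (Rabs_pos (a 0%nat)). simpl in H. lra. }
  assert (Hm : forall u, Rabs (2 * x * u) <= 2 * Rabs u).
  { intros u. rewrite !Rabs_mult, (Rabs_right 2) by lra.
    pose proof (Rabs_pos u). pose proof (Rabs_pos x). nra. }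
  assert (H : forall n, Rabs (b n) <= 3 * A * 4 ^ n /\
                        Rabs (b (S n)) <= 3 * A * 4 ^ S n); [|apply H].
  induction n as [|n [I1 I2]].
  - pose proof (HA 0%nat) as E0. pose proof (HA 1%nat) as E1. simpl in *.
    rewrite H1, H0. split; [lra|].
    eapply Rle_trans; [apply Rabs_triang|].
    pose proof (Hm (a 0%nat)). lra.
  - split; [exact I2|]. rewrite H2.
    eapply Rle_trans; [apply Rabs_triang|].
    pose proof (HA (S (S n))) as E.
    assert (Rabs (2 * x * b (S n) - b n) <= 2 * Rabs (b (S n)) + Rabs (b n)).
    { eapply Rle_trans; [apply Rabs_triang|]. rewrite Rabs_Ropp.
      pose proof (Hm (b (S n))). lra. }
    simpl in *. pose proof (pow_lt 4 n). nra.
Qed.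

(** Multiplication by the quadratic combines [b] with its two shifts. The first two coefficients are
    separate because the shifts start with zeros. *)
Lemma PSeries_step (x r : R) (a b : nat -> R) :
  ex_pseries b r ->
  b 0%nat = a 0%nat -> b 1%nat = 2 * x * b 0%nat + a 1%nat ->
  (forall n, b (S (S n)) = 2 * x * b (S n) - b n + a (S (S n))) ->
  PSeries b r * (1 - 2 * x * r + r ^ 2) = PSeries a r.
Proof.
  intros Hb H0 H1 H2.
  rewrite <- (PSeries_ext (PS_plus b
    (PS_plus (PS_scal (- 2 * x) (PS_incr_1 b)) (PS_incr_1 (PS_incr_1 b)))) a r).
  - assert (Hb1 : ex_pseries (PS_incr_1 b) r) by (apply ex_pseries_incr_1, Hb).
    assert (Hb2 : ex_pseries (PS_incr_1 (PS_incr_1 b)) r)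
      by (apply ex_pseries_incr_1, Hb1).
    assert (Hb3 : ex_pseries (PS_scal (- 2 * x) (PS_incr_1 b)) r)
      by (apply ex_pseries_scal; [apply Rmult_comm|exact Hb1]).
    rewrite (PSeries_plus _ _ _ Hb (ex_pseries_plus _ _ _ Hb3 Hb2)).
    rewrite (PSeries_plus _ _ _ Hb3 Hb2).
    rewrite PSeries_scal, !PSeries_incr_1.
    ring.
  - intros [|[|n]]; unfold PS_plus, PS_scal, PS_incr_1, plus, scal, zero; simpl;
      unfold mult; simpl; [rewrite H0 | rewrite H1, ?H0 | rewrite H2]; ring.
Qed.

(** Raising [lam] by one divides the series by the quadratic, so a proposed closed form is checked
    through a recurrence and two initial values. *)
Lemma gegenbauer_coeffs_step (lam : nat) (x : R) (a b : nat -> R) :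
  Rabs x <= 1 -> gegenbauer_coeffs lam x a ->
  b 0%nat = a 0%nat -> b 1%nat = 2 * x * b 0%nat + a 1%nat ->
  (forall n, b (S (S n)) = 2 * x * b (S n) - b n + a (S (S n))) ->
  gegenbauer_coeffs (S lam) x b.
Proof.
  intros Hx [Ha Hs] H0 H1 H2.
  assert (Hb : geom_bounded b) by (eapply geom_bounded_step; eauto).
  split; [exact Hb|]. intros r Hr.
  pose proof (PSeries_step x r a b) as E.
  rewrite <- tech_pow_Rmult, <- Rmult_assoc, E; auto.
  apply CV_radius_inside, geom_bounded_CV_radius; auto.
Qed.

(** Near 0 the quadratic is positive, so the generating function coincides with the series, whose
    derivatives at 0 yield the coefficients. *)
Lemma gegenbauer_of_coeffs (lam n : nat) (x : R) (a : nat -> R) :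
  Rabs x <= 1 -> gegenbauer_coeffs lam x a -> gegenbauer (INR lam) n x = a n.
Proof.
  intros Hx [Ha Hs]. unfold gegenbauer.
  rewrite (Derive_n_ext_loc _ (PSeries a)).
  - rewrite Derive_n_coef.
    + field. apply INR_fact_neq_0.
    + rewrite <- Rabs_R0. apply geom_bounded_CV_radius; [exact Ha|].
      rewrite Rabs_R0. lra.
  - assert (H4 : 0 < / 4) by lra. exists (mkposreal _ H4). intros r Hr.
    change (Rabs (r - 0) < / 4) in Hr. rewrite Rminus_0_r in Hr.
    assert (Hq : 0 < 1 - 2 * x * r + r ^ 2).
    { apply Rabs_def2 in Hr. apply Rabs_le_between in Hx. nra. }
    unfold gegenbauer_gen. rewrite Rpower_Ropp, Rpower_pow by exact Hq.
    pose proof (pow_lt _ lam Hq). pose proof (Hs r Hr).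
    apply Rmult_eq_reg_r with ((1 - 2 * x * r + r ^ 2) ^ lam); [|lra].
    rewrite Rinv_l; lra.
Qed.

(** * Closed forms in cosines of multiple angles *)

Definition mcos (x : R) (n : nat) : R := cos (INR n * x).

Lemma mcos_0 (x : R) : mcos x 0 = 1.
Proof. unfold mcos. simpl. rewrite Rmult_0_l. apply cos_0. Qed.

Lemma mcos_1 (x : R) : mcos x 1 = cos x.
Proof. unfold mcos. simpl. rewrite Rmult_1_l. reflexivity. Qed.

Lemma mcos_rec (x : R) (n : nat) :
  mcos x (S (S n)) = 2 * cos x * mcos x (S n) - mcos x n.
Proof.
  unfold mcos. rewrite !S_INR. set (u := INR n).
  replace ((u + 1 + 1) * x) with ((u + 1) * x + x) by ring.
  replace (u * x) with ((u + 1) * x - x) by ring.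
  rewrite cos_plus, cos_minus. ring.
Qed.

Lemma sin_pow_even (x : R) (m : nat) : sin x ^ (2 * m) = (1 - cos x ^ 2) ^ m.
Proof.
  rewrite pow_mult. f_equal. pose proof (sin2_cos2 x). unfold Rsqr in *. simpl; lra.
Qed.

Lemma one_minus_cos2_neq_0 (x : R) : sin x <> 0 -> 1 - cos x ^ 2 <> 0.
Proof.
  intros Hs. pose proof (sin_pow_even x 1) as H. rewrite pow_1 in H. rewrite <- H.
  apply pow_nonzero, Hs.
Qed.

(* Multiples of [x] are reduced to [mcos x n], [mcos x (S n)] and [cos x], after
   which the recurrence is a rational identity. *)
Ltac gegenbauer_coeffs_step_tac prev :=
  eapply gegenbauer_coeffs_step;
    [apply Rabs_le, COS_bound | apply prev; assumption | ..];
    intros; cbv beta; cbn [Nat.add Nat.mul];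
    rewrite !mcos_rec, ?mcos_0, ?mcos_1, ?S_INR; simpl (INR 0); field;
    apply one_minus_cos2_neq_0; assumption.

(** This is sin ((n+1) x) / sin x, since cos (n x) - cos ((n+2) x) = 2 sin ((n+1) x) sin x. *)
Lemma gegenbauer_coeffs_cos_1 (x : R) :
  sin x <> 0 ->
  gegenbauer_coeffs 1 (cos x)
    (fun n => (mcos x n - mcos x (2 + n)) / (2 * (1 - cos x ^ 2))).
Proof. intros Hs. gegenbauer_coeffs_step_tac gegenbauer_coeffs_0. Qed.

Lemma gegenbauer_coeffs_cos_2 (x : R) :
  sin x <> 0 ->
  gegenbauer_coeffs 2 (cos x)
    (fun n => ((INR n + 3) * mcos x n - 2 * (INR n + 2) * mcos x (2 + n)
               + (INR n + 1) * mcos x (4 + n)) / (8 * (1 - cos x ^ 2) ^ 2)).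
Proof. intros Hs. gegenbauer_coeffs_step_tac gegenbauer_coeffs_cos_1. Qed.

Lemma gegenbauer_coeffs_cos_3 (x : R) :
  sin x <> 0 ->
  gegenbauer_coeffs 3 (cos x)
    (fun n => ((INR n + 4) * (INR n + 5) * mcos x n
               - 3 * (INR n + 2) * (INR n + 5) * mcos x (2 + n)
               + 3 * (INR n + 4) * (INR n + 1) * mcos x (4 + n)
               - (INR n + 2) * (INR n + 1) * mcos x (6 + n))
              / (64 * (1 - cos x ^ 2) ^ 3)).
Proof. intros Hs. gegenbauer_coeffs_step_tac gegenbauer_coeffs_cos_2. Qed.

(** * Combinations of iterated integrals *)

Definition comb (c : nat -> R) (n m j : nat) (t : R) : R :=
  sum_f_R0 (fun i => c i * icos (INR (2 * i + n)) j t) m.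

Lemma is_derive_comb (c : nat -> R) (n m j : nat) (t : R) :
  is_derive (comb c n m (S j)) t (comb c n m j t).
Proof.
  unfold comb. induction m as [|m IH].
  - apply (is_derive_scal (icos _ (S j))), is_derive_icos.
  - apply (is_derive_plus (V := R_NormedModule)); [exact IH|].
    apply (is_derive_scal (icos _ (S j))), is_derive_icos.
Qed.

Lemma continuous_comb_0 (c : nat -> R) (n m : nat) (t : R) :
  continuous (comb c n m 0) t.
Proof.
  unfold comb. induction m as [|m IH].
  - apply (continuous_scal_r (V := R_NormedModule) (c 0%nat)), continuous_icos.
  - apply (continuous_plus (V := R_NormedModule)); [exact IH|].
    apply (continuous_scal_r (V := R_NormedModule) (c (S m))), continuous_icos.
Qed.

Lemma comb_S_0 (c : nat -> R) (n m j : nat) : comb c n m (S j) 0 = 0.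
Proof.
  unfold comb. induction m as [|m IH]; cbn [sum_f_R0]; rewrite ?IH, icos_S_0; ring.
Qed.

Lemma comb_scal (c c' : nat -> R) (K : R) (n m j : nat) (t : R) :
  (forall i, (i <= m)%nat -> c' i = K * c i) -> comb c' n m j t = K * comb c n m j t.
Proof.
  intros H. unfold comb. rewrite scal_sum. apply sum_eq.
  intros i Hi. rewrite (H i Hi). ring.
Qed.

(** Each term is an instance of [icos_SS]. The monomial is the same for all frequencies, so it
    collects the total weight. *)
Lemma comb_SS (c : nat -> R) (n m j : nat) (k t : R) :
  comb (fun i => c i * (k ^ 2 - INR (2 * i + n) ^ 2)) n m (S (S j)) t
  = comb c n m j t + k ^ 2 * comb c n m (S (S j)) t
    - sum_f_R0 c m * (t ^ j / INR (fact j)).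
Proof.
  unfold comb. induction m as [|m IH]; cbn [sum_f_R0].
  - rewrite <- (icos_SS (INR (2 * 0 + n)) j t). ring.
  - rewrite IH. pose proof (icos_SS (INR (2 * S m + n)) j t) as E.
    rewrite <- E. ring.
Qed.

(** The first source [icos (INR n) 2] has positive zeros when n > 0, so strict positivity is asked
    on a dense set only. One step of [third_order_pos] makes it strict everywhere. *)
Definition weakly_pos (f : R -> R) : Prop :=
  (forall x, 0 <= x -> 0 <= f x) /\
  (forall a b, 0 < a -> a < b -> exists c, a < c < b /\ 0 < f c).

Lemma weakly_pos_scal (K : R) (f g : R -> R) :
  0 < K -> (forall x, g x = K * f x) -> weakly_pos f -> weakly_pos g.
Proof.
  intros HK Hg [H1 H2]. split.
  - intros x Hx. rewrite Hg. apply Rmult_le_pos; [lra|auto].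
  - intros a b Ha Hab. destruct (H2 a b Ha Hab) as [c [Hc Hfc]].
    exists c. split; [exact Hc|]. rewrite Hg. apply Rmult_lt_0_compat; auto.
Qed.

Lemma weakly_pos_of_pos (f : R -> R) :
  0 <= f 0 -> (forall x, 0 < x -> 0 < f x) -> weakly_pos f.
Proof.
  intros H0 H. split.
  - intros x Hx. destruct (Rle_lt_or_eq_dec 0 x Hx) as [Hx'|<-]; [left|]; auto.
  - intros a b Ha Hab. exists ((a + b) / 2). split; [lra|apply H; lra].
Qed.

(* [d^3/dt^3 + k^2 d/dt] with [k = 2 * S m + n] annihilates the last term of the
   combination up to a monomial, which drops out because the weights sum to 0. *)
Lemma comb_pos_step (c c' : nat -> R) (K : R) (n m j : nat) :
  sum_f_R0 c (S m) = 0 -> 0 < K ->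
  (forall i, (i <= m)%nat ->
     c i * (INR (2 * S m + n) ^ 2 - INR (2 * i + n) ^ 2) = K * c' i) ->
  weakly_pos (comb c' n m (S (S j))) ->
  forall t, 0 < t -> 0 < comb c n (S m) (S (S (S j))) t.
Proof.
  intros Hc HK Hc' Hpos.
  set (k := INR (2 * S m + n)) in *.
  set (d := fun i => c i * (k ^ 2 - INR (2 * i + n) ^ 2)).
  assert (Hd : forall x, comb d n (S m) (S (S j)) x = K * comb c' n m (S (S j)) x).
  { intros x. rewrite <- (comb_scal c' d K n m) by exact Hc'.
    (* The factor k^2 - k^2 kills the term of index [S m]. *)
    unfold comb. cbn [sum_f_R0]. unfold d at 2. fold k. ring. }
  destruct (weakly_pos_scal K _ _ HK Hd Hpos) as [P1 P2].
  apply (third_order_pos k (comb c n (S m) (S (S (S j)))) (comb c n (S m) (S (S j)))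
           (comb c n (S m) (S j)) (comb d n (S m) (S (S j)))); auto using comb_S_0.
  - apply pos_INR.
  - intros; apply is_derive_comb.
  - intros; apply is_derive_comb.
  - intros x. unfold d. rewrite comb_SS, Hc.
    replace (_ - k ^ 2 * _) with (comb c n (S m) j x) by ring.
    apply is_derive_comb.
Qed.

(** * Partial-fraction weights *)

Definition weight1 (i : nat) : R := match i with O => 1 | _ => -1 end.

(** As for [weight1] and [weight3], these are, up to a common positive factor, the partial-fraction
    coefficients of the product of the 1 / (s^2 + k_i^2) with k_i = n + 2 i: weight i is
    proportional to the product over l <> i of 1 / (k_l^2 - k_i^2). Hence the sum 0, and the
    reduction to the preceding weights on removing the last factor. *)
Definition weight2 (n : R) (i : nat) : R :=
  match i with O => n + 3 | 1%nat => - (2 * (n + 2)) | _ => n + 1 end.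

Definition weight3 (n : R) (i : nat) : R :=
  match i with
  | O => (n + 4) * (n + 5)
  | 1%nat => - (3 * (n + 2) * (n + 5))
  | 2%nat => 3 * (n + 4) * (n + 1)
  | _ => - ((n + 2) * (n + 1))
  end.

Ltac weight_eq :=
  intros [|[|[|i]]] Hi; try lia; cbn [Nat.add Nat.mul]; rewrite ?S_INR;
  unfold weight1, weight2, weight3; ring.

Lemma comb_weight1_pos (n : nat) (t : R) : 0 < t -> 0 < comb weight1 n 1 3 t.
Proof.
  pose proof (pos_INR n).
  (* The constant is (n + 2)^2 - n^2, read off at index 0; the later constants arise likewise. *)
  apply (comb_pos_step weight1 (fun _ => 1) (4 * (INR n + 1)) n 0 0).
  - simpl. ring.
  - lra.
  - weight_eq.
  - apply (weakly_pos_scal 1 (icos (INR n) 2)); [lra| |].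
    + intros x. unfold comb. cbn [sum_f_R0]. reflexivity.
    + split; intros; [apply icos_2_ge0|apply icos_2_dense; auto].
Qed.

Lemma comb_weight2_pos (n : nat) (t : R) : 0 < t -> 0 < comb (weight2 (INR n)) n 2 4 t.
Proof.
  pose proof (pos_INR n).
  apply (comb_pos_step (weight2 (INR n)) weight1 (8 * (INR n + 2) * (INR n + 3)) n 1 1).
  - simpl. ring.
  - nra.
  - weight_eq.
  - apply weakly_pos_of_pos; [rewrite comb_S_0; lra|apply comb_weight1_pos].
Qed.

Lemma comb_weight3_pos (n : nat) (t : R) : 0 < t -> 0 < comb (weight3 (INR n)) n 3 5 t.
Proof.
  pose proof (pos_INR n).
  apply (comb_pos_step (weight3 (INR n)) (weight2 (INR n))
           (12 * (INR n + 4) * (INR n + 5)) n 2 2).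
  - simpl. ring.
  - nra.
  - weight_eq.
  - apply weakly_pos_of_pos; [rewrite comb_S_0; lra|apply comb_weight2_pos].
Qed.

(** * The integral as a combination *)

Lemma F_comb (lam n m : nat) (c : nat -> R) (K t : R) :
  0 < t <= PI ->
  (forall x, sin x <> 0 ->
     gegenbauer (INR lam) n (cos x) * sin x ^ (2 * lam) = K * comb c n m 0 x) ->
  F lam n t = INR (fact (lam + 1)) * K * comb c n m (S (lam + 1)) t.
Proof.
  intros Ht H. unfold F.
  (* The kernel (t - x)^(lam+1) / (lam+1)! amounts to lam + 2 integrations from level 0. *)
  pose proof (is_RInt_iterated (lam + 1) (comb c n m) t (is_derive_comb c n m)
    (continuous_comb_0 c n m) (comb_S_0 c n m)) as HI.
  apply (is_RInt_scal _ _ _ (INR (fact (lam + 1)) * K)) in HI.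
  apply is_RInt_unique. eapply is_RInt_ext; [|exact HI].
  intros x. rewrite Rmin_left, Rmax_right by lra. intros Hx.
  (* Only interior points matter, and there 0 < x < t <= PI. *)
  assert (Hs : sin x <> 0) by (apply Rgt_not_eq, sin_gt_0; lra).
  rewrite (Rmult_assoc _ (gegenbauer _ _ _)), (H x Hs).
  unfold scal; simpl; unfold mult; simpl.
  field. apply INR_fact_neq_0.
Qed.

Lemma F_pos (lam n m : nat) (c : nat -> R) (K t : R) :
  0 < t <= PI -> 0 < K ->
  (forall x, sin x <> 0 ->
     gegenbauer (INR lam) n (cos x) * sin x ^ (2 * lam) = K * comb c n m 0 x) ->
  0 < comb c n m (S (lam + 1)) t -> 0 < F lam n t.
Proof.
  intros Ht HK H Hc. rewrite (F_comb lam n m c K t Ht H).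
  apply Rmult_lt_0_compat; [|exact Hc].
  apply Rmult_lt_0_compat; [apply INR_fact_lt_0|exact HK].
Qed.

(** The even power of the sine cancels the denominator of the closed form, leaving a pure cosine
    sum. *)
Ltac comb_expansion lemma :=
  let x := fresh "x" in let Hs := fresh "Hs" in
  intros x Hs;
  erewrite gegenbauer_of_coeffs; [|apply Rabs_le, COS_bound|apply lemma, Hs];
  cbv beta; rewrite sin_pow_even;
  unfold comb, mcos, weight1, weight2, weight3; cbn [sum_f_R0]; cbn [icos]; cbn [Nat.add Nat.mul];
  field; apply one_minus_cos2_neq_0, Hs.

Theorem proposition1p5 (d lam n : nat) (t : R)
    (hd : d = 4%nat \/ d = 6%nat \/ d = 8%nat)
    (hlam : INR lam = (INR d - 2) / 2)
    (ht : 0 < t <= PI) :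
  0 < F lam n t.
Proof.
  assert (Hl : lam = 1%nat \/ lam = 2%nat \/ lam = 3%nat).
  { destruct hd as [->|[->| ->]]; [left|right; left|right; right];
      apply INR_eq; rewrite hlam; simpl; field. }
  destruct Hl as [->|[->| ->]].
  (* The constants 1/2, 1/8 and 1/64 come from the denominators of the closed forms. *)
  - apply (F_pos 1 n 1 weight1 (/ 2)); [exact ht|lra| |].
    + comb_expansion gegenbauer_coeffs_cos_1.
    + apply comb_weight1_pos; lra.
  - apply (F_pos 2 n 2 (weight2 (INR n)) (/ 8)); [exact ht|lra| |].
    + comb_expansion gegenbauer_coeffs_cos_2.
    + apply comb_weight2_pos; lra.
  - apply (F_pos 3 n 3 (weight3 (INR n)) (/ 64)); [exact ht|lra| |].
    + comb_expansion gegenbauer_coeffs_cos_3.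
    + apply comb_weight3_pos; lra.
Qed.
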